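(* Let $X$ be a locally compact normal (Hausdorff) space, let $F:X\to\mathcal P(X)$ be (the generator of) a discrete multivalued dynamical system on $X$ determined by a morphism, let $S$ be an isolated invariant set for $F$, $N$ an isolating neighbourhood for $S$, and $P=(P_1,P_2)$ a weak index pair in $N$. Let $C,D\subset P_1\cup(X\setminus\operatorname{int}N)$ be compact disjoint sets with $\operatorname{cl}(P_1\setminus P_2)\subset C$ and $X\setminus\operatorname{int}N\subset D$, and let $\alpha:X\to[0,1]$ be a continuous function with $\alpha|_C=0$ and $\alpha|_D=1$. Put $I=[0,1]$, $$\bar X:=(P_1\setminus P_2)\times\{0\}\cup(P_2\cup(X\setminus\operatorname{int}N))\times I\cup X\times\{1\}\subset X\times I,$$ $\mu(x,t):=t+(1-t)\alpha(x)$ for $(x,t)\in\bar X$, $\bar F(x,t):=F(x)\times\{\mu(x,t)\}$ for $(x,t)\in\bar X$, and $\bar S:=S\times\{0\}$. Then $\bar S$ is a strongly isolated invariant set for $\bar F$.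
   Context: $\mathcal P(X)$ is the set of all subsets of $X$; $\operatorname{int}$, $\operatorname{cl}$ denote interior and closure. A map $G:Y\to\mathcal P(X)$ is upper semicontinuous (usc) if $\{y\in Y\mid G(y)\cap B\neq\varnothing\}$ is closed for every closed $B\subset X$; $G(A)=\bigcup_{y\in A}G(y)$. A discrete multivalued dynamical system (dmds) is a usc map $F:X\times\mathbb Z\to\mathcal P(X)$ with compact values such that (i) $F(x,0)=\{x\}$; (ii) $F(F(x,n),m)=F(x,n+m)$ for all $x$ and all $n,m\in\mathbb Z$ with $nm\ge 0$; (iii) $y\in F(x,-1)\Leftrightarrow x\in F(y,1)$. The dmds is identified with its generator $F(x):=F(x,1)$. $F$ is determined by a morphism if there are a Hausdorff space $\Gamma$, a continuous proper surjection $p:\Gamma\to X$ with all fibres acyclic in Alexander–Spanier cohomology, and a continuous $q:\Gamma\to X$ with $F(x)=q(p^{-1}(x))$ for all $x\in X$. $\bar X$ carries the subspace topology of the product $X\times I$; $\bar F$ is a well-defined usc map $\bar X\to\mathcal P(\bar X)$ and generates a dmds on $\bar X$. For $N\subset X$, $\operatorname{Inv}N$ is the set of $x\in N$ for which there is $\sigma:\mathbb Z\to N$ with $\sigma(0)=x$ and $\sigma(n+1)\in F(\sigma(n))$ for all $n\in\mathbb Z$. A compact set $N$ is an isolating neighbourhood for $F$ if $\operatorname{Inv}N\subset\operatorname{int}N$, and a strongly isolating neighbourhood for $F$ if $\operatorname{Inv}N\cup F(\operatorname{Inv}N)\subset\operatorname{int}N$. A compact set $S$ with $S=\operatorname{Inv}S$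 is a (strongly) isolated invariant set if $S=\operatorname{Inv}N$ for some (strongly) isolating neighbourhood $N$; then $N$ is a (strongly) isolating neighbourhood for $S$. The same definitions apply to $\bar F$ on $\bar X$, with interiors taken in $\bar X$. Let $\operatorname{bd}_F(A):=\operatorname{cl}A\cap\operatorname{cl}(F(A)\setminus A)$. A weak index pair in $N$ is a pair $P=(P_1,P_2)$ of compact sets $P_2\subset P_1\subset N$ such that (a) $F(P_i)\cap N\subset P_i$, $i=1,2$; (b) $\operatorname{bd}_F(P_1)\subset P_2$; (c) $\operatorname{Inv}N\subset\operatorname{int}(P_1\setminus P_2)$; (d) $P_1\setminus P_2\subset\operatorname{int}N$. *)

(* Defs.v *)
From HB Require Import structures.
From mathcomp Require Import all_boot all_order all_algebra.
From mathcomp Require Import all_classical all_reals all_analysis.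

Set Implicit Arguments.
Unset Strict Implicit.
Unset Printing Implicit Defensive.

Import Order.TTheory GRing.Theory Num.Theory.
Import numFieldNormedType.Exports.

Local Open Scope classical_set_scope.
Local Open Scope ring_scope.

(** * Alexander-Spanier cohomology *)

Section AlexanderSpanier.
Variables (G : zmodType) (T : topologicalType).

Definition as_cochain (n : nat) := ('I_n.+1 -> T) -> G.

Definition as_delta n (phi : as_cochain n) : as_cochain n.+1 :=
  fun v => \sum_(i < n.+2) phi (fun j => v (lift i j)) *~ ((-1) ^+ i).

(* The Alexander-Spanier complex is the quotient of the complex of all cochains
   by the subcomplex of locally zero ones; classes are handled through
   representatives below. *)
Definition as_locally_zero n (phi : as_cochain n) :=
  forall x : T, exists2 U : set T, nbhs x U &
    forall v : 'I_n.+1 -> T, (forall i, U (v i)) -> phi v = 0.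

Definition as_cocycle n (phi : as_cochain n) := as_locally_zero (as_delta phi).

Definition as_coboundary n : as_cochain n -> Prop :=
  match n with
  | 0 => fun phi => as_locally_zero phi
  | m.+1 => fun phi => exists psi : as_cochain m,
      as_locally_zero (n := m.+1) (fun v => phi v - as_delta psi v)
  end.

(* The cohomology of a point: the constants G -> H^0(T; G) form an isomorphism
   (existence = surjective, uniqueness = injective), and H^n(T; G) = 0 for
   n > 0. *)
Definition as_acyclic :=
  (forall phi : as_cochain 0, as_cocycle phi ->
     exists! g : G, as_coboundary (n := 0) (fun v => phi v - g)) /\
  (forall n (phi : as_cochain n.+1), as_cocycle phi -> as_coboundary phi).

End AlexanderSpanier.

(** * Multivalued dynamics *)

Definition mimage (Y X : Type) (G : Y -> set X) (A : set Y) : set X :=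
  \bigcup_(y in A) G y.

Definition usc (Y X : topologicalType) (G : Y -> set X) :=
  forall B : set X, closed B -> closed [set y | G y `&` B !=set0].

Record dmds (X : topologicalType) (Phi : X -> int -> set X) : Prop := {
  dmds_usc :
    usc (fun z : (X * discrete_topology int)%type => Phi z.1 (z.2 : int));
  dmds_compact : forall x n, compact (Phi x n);
  dmds_zero : forall x, Phi x 0 = [set x];
  dmds_add : forall x (n m : int), 0 <= n * m ->
    mimage (fun y => Phi y m) (Phi x n) = Phi x (n + m);
  dmds_inv : forall x y, Phi x (-1) y <-> Phi y 1 x }.

Definition dmds_generator (X : topologicalType) (F : X -> set X) :=
  exists2 Phi : X -> int -> set X, dmds Phi & forall x, F x = Phi x 1.

Definition proper_map (Y X : topologicalType) (p : Y -> X) :=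
  forall K : set X, compact K -> compact (p @^-1` K).

(* The fibre is the subtype [set_type (p @^-1` [set x])], which carries the
   subspace topology. *)
Definition determined_by_morphism (G : zmodType) (X : topologicalType)
    (F : X -> set X) :=
  exists (Gamma : topologicalType) (p q : Gamma -> X),
    [/\ hausdorff_space Gamma,
        [/\ continuous p, proper_map p, set_surj [set: Gamma] [set: X] p &
            forall x, as_acyclic G (set_type (p @^-1` [set x]))],
        continuous q &
        forall x, F x = q @` (p @^-1` [set x])].

Section Invariance.
Variables (X : topologicalType) (F : X -> set X).

Definition Inv (N : set X) : set X :=
  [set x | N x /\ exists sigma : int -> X,
     [/\ forall n, N (sigma n), sigma 0 = x &
         forall n, F (sigma n) (sigma (n + 1))]].

Definition isolating_nbhd (N : set X) := compact N /\ Inv N `<=` N°.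

Definition strongly_isolating_nbhd (N : set X) :=
  compact N /\ Inv N `|` mimage F (Inv N) `<=` N°.

(* [Inv S] is taken inside [S]: this is the invariance of [S]. *)
Definition isolated_invariant_set (S : set X) :=
  [/\ compact S, S = Inv S & exists2 N, isolating_nbhd N & S = Inv N].

Definition strongly_isolated_invariant_set (S : set X) :=
  [/\ compact S, S = Inv S & exists2 N, strongly_isolating_nbhd N & S = Inv N].

Definition isolating_nbhd_for (N S : set X) := isolating_nbhd N /\ S = Inv N.

Definition bdF (A : set X) : set X :=
  closure A `&` closure (mimage F A `\` A).

Record weak_index_pair (N P1 P2 : set X) : Prop := {
  wip_compact1 : compact P1;
  wip_compact2 : compact P2;
  wip_sub21 : P2 `<=` P1;
  wip_sub1N : P1 `<=` N;
  wip_pos1 : mimage F P1 `&` N `<=` P1;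
  wip_pos2 : mimage F P2 `&` N `<=` P2;
  wip_bd : bdF P1 `<=` P2;
  wip_inv : Inv N `<=` (P1 `\` P2)°;
  wip_int : P1 `\` P2 `<=` N° }.

End Invariance.

(** * The extended system *)

Section Extension.
Variables (R : realType) (X : topologicalType).

Definition Xbar (N P1 P2 : set X) : set (X * R) :=
  ((P1 `\` P2) `*` [set 0])
  `|` ((P2 `|` ~` N°) `*` `[0, 1])
  `|` ([set: X] `*` [set 1]).

Definition mu (alpha : X -> R) (z : X * R) : R :=
  z.2 + (1 - z.2) * alpha z.1.

(* [Fbar] and [Sbar] live on the subtype of [X * R] given by [Xbar], with the
   subspace topology. Nothing is lost in taking preimages under the inclusion:
   see [Fbar_wd] and [Sbar_wd]. *)
Definition Fbar (F : X -> set X) (N P1 P2 : set X) (alpha : X -> R)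
    (z : set_type (Xbar N P1 P2)) : set (set_type (Xbar N P1 P2)) :=
  set_val @^-1` (F (set_val z).1 `*` [set mu alpha (set_val z)]).

Definition Sbar (N P1 P2 S : set X) : set (set_type (Xbar N P1 P2)) :=
  set_val @^-1` (S `*` [set 0]).

Lemma preimage_set_valK (A B : set (X * R)) : B `<=` A ->
  (set_val : set_type A -> X * R) @` (set_val @^-1` B) = B.
Proof.
move=> BA; apply/seteqP; split=> [_ [z Bz <-] //|z Bz].
by exists (SigSub (mem_set (BA _ Bz))); rewrite /= ?set_valE.
Qed.

Lemma Fbar_wd (F : X -> set X) (N P1 P2 C D : set X) (alpha : X -> R) :
  weak_index_pair F N P1 P2 ->
  closure (P1 `\` P2) `<=` C -> ~` N° `<=` D ->
  (forall x, 0 <= alpha x <= 1) ->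
  (forall x, C x -> alpha x = 0) -> (forall x, D x -> alpha x = 1) ->
  forall z : set_type (Xbar N P1 P2),
    set_val @` Fbar F alpha z
    = F (set_val z).1 `*` [set mu alpha (set_val z)].
Proof.
move=> wip PC ND aI aC aD z; apply: preimage_set_valK => -[y s] /= [Fy ->].
have := set_valP z; move: Fy; rewrite -set_valE; case: (set_val z) => x t /= Fy.
case=> [[]|] [/=]; last by move=> _ ->; right; rewrite /mu /= subrr mul0r addr0.
- move=> Px ->; have /PC/aC a0 := @subset_closure _ (P1 `\` P2) x Px.
  rewrite /mu /= a0 mulr0 addr0; left.
  have [Ny|nNy] := pselect (N y); last first.
    right; split => /=; last by rewrite in_itv /= lexx ler01.
    by right => /interior_subset.
  have P1y : P1 y by apply: (wip_pos1 wip); split => //; exists x; case: Px.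
  have [P2y|] := pselect (P2 y); last by left.
  by right; split; [left|rewrite /= in_itv /= lexx ler01].
- move=> [P2x|nNx] tI; last first.
    by right; split => //=; rewrite /mu /= (aD _ (ND _ nNx)) mulr1 addrC subrK.
  left; right; split=> /=; last first.
    have := aI x; move: tI; rewrite /mu /= !in_itv /=.
    move=> /andP[t0 t1] /andP[a0 a1]; apply/andP; split.
      by rewrite addr_ge0// mulr_ge0// subr_ge0.
    by rewrite -lerBrDl ler_piMr// subr_ge0.
  have [Ny|nNy] := pselect (N y); last by right => /interior_subset.
  by left; apply: (wip_pos2 wip); split => //; exists x.
Qed.

Lemma Sbar_wd (F : X -> set X) (N P1 P2 S : set X) :
  weak_index_pair F N P1 P2 -> isolating_nbhd_for F N S ->
  set_val @` @Sbar N P1 P2 S = S `*` [set 0 : R].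
Proof.
move=> wip [_ ->]; apply: preimage_set_valK => -[x t] /= [Sx ->].
by left; left; split=> //; exact: interior_subset (wip_inv wip Sx).
Qed.

End Extension.

Arguments Fbar {R X} F N P1 P2 alpha z.
Arguments Sbar R {X} N P1 P2 S.

(* Main.v *)
Require Import Defs.
From HB Require Import structures.
From mathcomp Require Import all_boot all_order all_algebra.
From mathcomp Require Import all_classical all_reals all_analysis.
Import Order.TTheory GRing.Theory Num.Theory.
Import numFieldNormedType.Exports.
Local Open Scope classical_set_scope.
Local Open Scope ring_scope.

Set Implicit Arguments.
Unset Strict Implicit.
Unset Printing Implicit Defensive.

(** The second coordinate of the extended space is a height which [Fbar] never
    lowers, and [alpha] dictates where it rises: over [C] it is kept, over [D]
    it jumps to [1].  A full orbit of [Fbar] that stays at heights at most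
    [1/2] can therefore never be over [D], in particular it stays over the
    interior of [N], and its projection is a full orbit of [F] in [N]; so it
    lies over [S].  Over [S], which is contained in [P1 `\` P2], the extended
    space has height [0] or [1] only, hence the orbit lies in [S * {0}].
    Conversely, [alpha] vanishes on [S], so that orbits of [F] in [S] lift to
    height [0].  Thus [Sbar] is the invariant part of the lower half of the
    extended space ([Sbar_invariant], [Inv_lower_half_sub]).

    The isolation is strong because [Fbar] maps [Sbar] into height [0], and
    every point of height less than [1/2] is interior to the lower half: the
    points of [F S] that leave [N] are still accommodated, the whole segment
    above them being part of the extended space.  The lower half is compact,
    because adding [P2 * {0}] to [(P1 `\` P2) * {0}] turns it into [P1 * {0}],
    and the complement of the interior of [N] is closed in the compact [D]. *)

(** A filter containing [K] clusters in [T] at a point of [K], which is a point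
    of the subspace since [K] is contained in [A]; and neighbourhoods in the
    subspace are traces of neighbourhoods in [T]. *)
Lemma compact_preimage_set_val (T : topologicalType) (A K : set T) :
  compact K -> K `<=` A -> compact ((set_val : set_type A -> T) @^-1` K).
Proof.
move=> cK KA Phi PPhi PhiK.
have [x [Kx clx]] := cK (set_val @ Phi) _ PhiK.
exists (SigSub (mem_set (KA _ Kx))); split; first by rewrite /= set_valE.
move=> U V PhiU [W [[W' oW' <-] W'x WV]].
have [y [[z Uz <-] W'z]] : set_val @` U `&` W' !=set0.
  apply: clx.
    suff : Phi (set_val @^-1` (set_val @` U)) by [].
    by apply: filterS PhiU => z Uz; exists z.
  by apply: open_nbhs_nbhs; split=> //; move: W'x; rewrite /= set_valE.
by exists z; split=> //; exact: WV.
Qed.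

Section LowerHalf.
Variables (R : realType) (X : topologicalType).
Implicit Types (F : X -> set X) (S N P D : set X) (alpha : X -> R).

Lemma mu_eq1 alpha x t : alpha x = 1 -> mu alpha (x, t) = 1.
Proof. by rewrite /mu /= => ->; rewrite mulr1 addrC subrK. Qed.

Lemma mu_eq0 alpha x : alpha x = 0 -> mu alpha (x, 0) = 0.
Proof. by rewrite /mu /= => ->; rewrite mulr0 addr0. Qed.

(** The part of the extended space of height at most [1/2], written as a union
    of products of compact sets. *)
Definition lower_half (N P1 P2 : set X) : set (X * R) :=
  P1 `*` [set 0] `|` (P2 `|` ~` N°) `*` `[0, 2^-1].

Lemma compact_lower_half N P1 P2 D : compact P1 -> compact P2 -> compact D ->
  ~` N° `<=` D -> compact (lower_half N P1 P2).
Proof.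
move=> cP1 cP2 cD ND; apply: compactU; apply: compact_setX => //.
- exact: compact_set1.
- apply: compactU => //; apply: subclosed_compact cD ND.
  exact/open_closedC/open_interior.
- exact: segment_compact.
Qed.

Lemma lower_half_Xbar N P1 P2 : lower_half N P1 P2 `<=` Xbar N P1 P2.
Proof.
move=> [x t] [[/= P1x ->]|[/= PNx]].
  have [P2x|nP2x] := pselect (P2 x); last by left; left.
  by left; right; split; [left|rewrite /= in_itv /= lexx ler01].
rewrite in_itv /= => /andP[t0 t2]; left; right; split=> //=.
by rewrite in_itv /= t0 (le_trans t2)// invf_le1// ler1n.
Qed.

Lemma lower_half_le N P1 P2 z : lower_half N P1 P2 z -> z.2 <= 2^-1.
Proof.
case=> -[_ /=]; first by move=> ->; rewrite invr_ge0.
by rewrite in_itv /= => /andP[].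
Qed.

(** The bound [1/2] only serves to leave out the sheet [X * {1}]: below it the
    extended space is [P1 * {0}] and the segments over [P2] and outside the
    interior of [N]. *)
Lemma Xbar_lower_half N P1 P2 z :
  Xbar N P1 P2 z -> z.2 < 2^-1 -> lower_half N P1 P2 z.
Proof.
case: z => x t /= [[[/= [P1x _] ->]|[/= PNx]]|[_ /= ->]] => [_||].
- by left.
- by rewrite in_itv /= => /andP[t0 _] t2; right; split=> //=;
    rewrite in_itv /= t0 ltW.
- by rewrite ltNge invf_le1// ler1n.
Qed.

Local Notation lower N P1 P2 := ((set_val : set_type (Xbar N P1 P2) -> X * R)
  @^-1` lower_half N P1 P2).

Lemma interior_lower_half N P1 P2 (z : set_type (Xbar N P1 P2)) :
  (set_val z).2 < 2^-1 -> (lower N P1 P2)° z.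
Proof.
move=> z2; apply: filterS; last first.
  apply: (@open_nbhs_nbhs _ z (set_val @^-1` (snd @^-1` `]-oo, 2^-1[%classic))).
  split; last by rewrite /= in_itv.
  exists (snd @^-1` `]-oo, 2^-1[%classic) => //.
  by apply: open_comp => [? _|]; [apply: cvg_snd|exact: interval_open].
move=> w /=; rewrite in_itv /=; apply: Xbar_lower_half; exact: set_valP.
Qed.

(** [alpha] vanishes on [S], so an orbit of [F] in [S] becomes an orbit of
    [Fbar] when it is put at height [0]. *)
Lemma Sbar_invariant F N P1 P2 S alpha : S = Defs.Inv F S -> S `<=` P1 `\` P2 ->
  (forall x, S x -> alpha x = 0) ->
  Sbar R N P1 P2 S `<=` Defs.Inv (Fbar F N P1 P2 alpha) (Sbar R N P1 P2 S).
Proof.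
move=> SE SP aS z [/= Sz1 z20]; split=> //.
have XS x : S x -> Xbar N P1 P2 (x, 0 : R) by left; left; split=> //; exact: SP.
move: (Sz1); rewrite {1}SE => -[_ [s [sS s0 sF]]].
exists (fun n => SigSub (mem_set (XS _ (sS n)))); split=> [n||n].
- by split; rewrite /= ?set_valE //; exact: sS.
- apply: val_inj => /=; by rewrite s0 -z20 -surjective_pairing set_valE.
- by split; rewrite /= ?set_valE /=; [exact: sF|rewrite mu_eq0// aS].
Qed.

(** At an orbit point over the complement of [N°] the next height would be
    [1]; so the orbit projects into [N], and by invariance into [S], over
    which the only height at most [1/2] is [0]. *)
Lemma Inv_lower_half_sub F N P1 P2 alpha :
  Defs.Inv F N `<=` P1 `\` P2 -> Defs.Inv F N `<=` N° ->
  (forall x, ~ N° x -> alpha x = 1) ->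
  Defs.Inv (Fbar F N P1 P2 alpha) (lower N P1 P2)
    `<=` Sbar R N P1 P2 (Defs.Inv F N).
Proof.
move=> IP IN aN _ [_ [s [sK <- sF]]].
have sN n : N° (set_val (s n)).1.
  apply: contrapT => nN; have [_ /= s1] := sF n.
  have := lower_half_le (sK (n + 1)).
  rewrite s1 [set_val _]surjective_pairing mu_eq1; last exact: aN.
  by rewrite leNgt invf_lt1 ?ltr1n.
have I0 : Defs.Inv F N (set_val (s 0)).1.
  split; first exact: interior_subset.
  exists (fun n => (set_val (s n)).1); split=> // n.
    exact: interior_subset.
  by have [] := sF n.
split=> //; have [_ nP2] := IP _ I0.
by case: (sK 0) => -[// [] /= nN]; [case: (nP2 nN)|case: nN; exact: IN].
Qed.

End LowerHalf.

Theorem theorem7p7 (G : zmodType) (R : realType) (X : topologicalType)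
    (F : X -> set X) (S N P1 P2 C D : set X) (alpha : X -> R)
    (X_locally_compact : locally_compact [set: X])
    (X_normal : normal_space X)
    (X_hausdorff : hausdorff_space X)
    (F_dmds : dmds_generator F)
    (F_morphism : determined_by_morphism G F)
    (S_isolated : isolated_invariant_set F S)
    (N_isolating : isolating_nbhd_for F N S)
    (P_weak_index_pair : weak_index_pair F N P1 P2)
    (C_sub : C `<=` P1 `|` ~` N°) (D_sub : D `<=` P1 `|` ~` N°)
    (C_compact : compact C) (D_compact : compact D)
    (CD_disjoint : C `&` D = set0)
    (P_sub_C : closure (P1 `\` P2) `<=` C)
    (N_sub_D : ~` N° `<=` D)
    (alpha_continuous : continuous alpha)
    (alpha_unit : forall x, 0 <= alpha x <= 1)
    (alpha_C : forall x, C x -> alpha x = 0)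
    (alpha_D : forall x, D x -> alpha x = 1) :
  strongly_isolated_invariant_set
    (Fbar F N P1 P2 alpha) (Sbar R N P1 P2 S).
Proof.
have [S_compact S_inv _] := S_isolated.
have [[_ IN] SE] := N_isolating.
have SP : S `<=` P1 `\` P2.
  rewrite SE => x Ix; exact: interior_subset (wip_inv P_weak_index_pair Ix).
have alpha_S x : S x -> alpha x = 0.
  by move=> Sx; apply/alpha_C/P_sub_C/subset_closure/SP.
have Sbar_sub := Sbar_invariant (N := N) S_inv SP alpha_S.
pose K := (set_val : set_type (Xbar N P1 P2) -> X * R)
  @^-1` lower_half N P1 P2.
have Sbar_K : Sbar R N P1 P2 S `<=` K.
  by move=> z [/= /SP[P1z _] z20]; left.
have Inv_lower_half : Sbar R N P1 P2 S = Defs.Inv (Fbar F N P1 P2 alpha) K.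
  apply/seteqP; split=> [z /Sbar_sub[Sz [s [sS s0 sF]]]|].
    by split; [exact: Sbar_K|exists s; split=> // n; exact: Sbar_K].
  rewrite SE; apply: Inv_lower_half_sub => //; first by rewrite -SE.
  by move=> x nNx; exact/alpha_D/N_sub_D.
split.
- apply: compact_preimage_set_val.
    by apply: compact_setX => //; exact: compact_set1.
  by move=> [x t] [/= Sx ->]; left; left; split=> //; exact: SP.
- by apply/seteqP; split=> // z [].
- exists K => //; split.
    apply: compact_preimage_set_val; last exact: lower_half_Xbar.
    exact: (compact_lower_half (wip_compact1 P_weak_index_pair)
      (wip_compact2 P_weak_index_pair) D_compact N_sub_D).
  rewrite -Inv_lower_half => z Sz; apply: interior_lower_half.
  have -> : (set_val z).2 = 0; last by rewrite invr_gt0.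
  case: Sz => [[_ //]|[w [/= Sw w20] [_ ->]]].
  by rewrite [set_val w]surjective_pairing w20 mu_eq0// alpha_S.
Qed.
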